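(* Let $p$ be a prime, $q=p^n$ with $n\ge 1$, let $m>1$ be an integer, and let $l$ and $k$ be positive integers with $l\le k$. Let $L(x)\in\mathbf{F}_{q^m}[x]$ be a linearized polynomial such that $\dim(\mathrm{Ker}(L))=k$ and $\mathrm{Ker}(L)\cap\mathrm{Im}(L)=\{0\}$. Let $\gamma_1,\dots,\gamma_l\in\mathrm{Ker}(L)$ be linearly independent over $\mathbf{F}_q$ and let $h_1(x),\dots,h_l(x)\in\mathbf{F}_{q^m}[x]$. Then $F(x):=L(x)+\sum_{i=1}^l\gamma_i\,\mathrm{Tr}_{\mathbf{F}_{q^m}/\mathbf{F}_q}(h_i(x))$ is a permutation polynomial of $\mathbf{F}_{q^m}$ if and only if there exists an integer $i$ with $1\le i\le l$ such that $\mathrm{Tr}_{\mathbf{F}_{q^m}/\mathbf{F}_q}(h_i(x+\varepsilon)-h_i(x))\neq 0$ for any $x\in\mathbf{F}_{q^m}$ and any $\varepsilon\in\mathrm{Ker}(L)\setminus\{0\}$.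
   Context: $\mathbf{F}_{r}$ denotes the finite field with $r$ elements. $\mathrm{Tr}_{\mathbf{F}_{q^m}/\mathbf{F}_q}(x)=x+x^q+\cdots+x^{q^{m-1}}$ is the trace from $\mathbf{F}_{q^m}$ to $\mathbf{F}_q$. A polynomial is a permutation polynomial of a finite field if it induces a permutation of that field. A linearized polynomial over $\mathbf{F}_{q^m}$ is a polynomial of the form $L(x)=\sum_{i=0}^{m-1}a_i x^{q^i}\in\mathbf{F}_{q^m}[x]$; it induces an $\mathbf{F}_q$-linear map on $\mathbf{F}_{q^m}$ with kernel $\mathrm{Ker}(L)$ and image $\mathrm{Im}(L)$ in $\mathbf{F}_{q^m}$, and $\dim$ denotes dimension over $\mathbf{F}_q$.
   Formalization: The condition is taken with i allowed to depend on x and ε: for any x and any nonzero ε in Ker(L) there exists i with Tr(h_i(x+ε)−h_i(x)) ≠ 0; with one i for all x and ε the claim fails when l=k≥2. *)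

(* Defs.v *)
From HB Require Import structures.
From mathcomp Require Import all_boot all_order all_algebra all_fingroup all_field.
Set Implicit Arguments.
Unset Strict Implicit.
Unset Printing Implicit Defensive.
Import GRing.Theory.
Local Open Scope ring_scope.

(* The field with q elements is K, and the field with q ^ m elements is an
   extension E of K with \dim {:E} = m. *)

(* Used both for the trace polynomial Tr(h(x)) in {poly E} and for the trace of
   an element of E; the latter is the image in E of an element of K. *)
Definition Tr (R : nzRingType) (q m : nat) (x : R) : R :=
  \sum_(i < m) x ^+ (q ^ i).

Definition linearized (R : nzRingType) (q m : nat) (L : {poly R}) : Prop :=
  exists a : 'I_m -> R, L = \sum_(i < m) a i *: 'X^(q ^ i).

Definition permutation_poly (R : nzRingType) (f : {poly R}) : Prop :=
  bijective (fun x : R => f.[x]).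

Section Induced.

Variables (K : finFieldType) (E : fieldExtType K).

(* linfun only represents linear functions; poly_linE below shows that this is
   the evaluation map when L is linearized. *)
Definition poly_lin (L : {poly E}) : 'End(E) := linfun (fun x : E => L.[x]).

Definition Ker (L : {poly E}) : {vspace E} := lker (poly_lin L).
Definition Im (L : {poly E}) : {vspace E} := limg (poly_lin L).

Lemma expf_cardX (c : K) i : c ^+ (#|K| ^ i) = c.
Proof. by elim: i => [|i IH]; rewrite ?expr1 // expnS exprM expf_card. Qed.

Lemma exprD_cardX (x y : E) i :
  (x + y) ^+ (#|K| ^ i) = x ^+ (#|K| ^ i) + y ^+ (#|K| ^ i).
Proof.
have [p p_pr pcharKp] := finPcharP K.
have pcharEp : p \in [pchar E] by rewrite pchar_lalg.
apply: exprDn_pchar; rewrite (eq_pnat _ (pcharf_eq pcharEp)).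
by rewrite (card_pprimeChar pcharKp) !pnatX pnat_id.
Qed.

Lemma linearized_is_linear m (L : {poly E}) :
  linearized #|K| m L -> linear (fun x : E => L.[x]).
Proof.
case=> a -> c x y; rewrite !horner_sum scaler_sumr -big_split /=.
apply: eq_bigr => i _; rewrite !hornerE exprD_cardX exprZn expf_cardX.
by rewrite mulrDr scalerAr.
Qed.

Lemma poly_linE m (L : {poly E}) :
  linearized #|K| m L -> forall x, poly_lin L x = L.[x].
Proof.
move=> /linearized_is_linear linL x.
pose f := GRing.isLinear.Build K E E _ _ linL.
pose g : {linear E -> E} := HB.pack (fun x : E => L.[x]) f.
exact: (lfunE g).
Qed.

Lemma mem_Ker m (L : {poly E}) :
  linearized #|K| m L -> forall x, (x \in Ker L) = root L x.
Proof. by move=> linL x; rewrite memv_ker (poly_linE linL). Qed.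

Lemma mem_Im m (L : {poly E}) :
  linearized #|K| m L ->
  forall y, reflect (exists x, y = L.[x]) (y \in Im L).
Proof.
move=> linL y; apply: (iffP memv_imgP) => [[x _ ->]|[x ->]]; exists x.
- exact: poly_linE linL x.
- exact: memvf.
- by rewrite (poly_linE linL).
Qed.

End Induced.

(* Main.v *)
Require Import Defs.
From mathcomp Require Import all_boot all_order all_algebra all_fingroup all_field.
Import GRing.Theory.
Local Open Scope ring_scope.

(** Since [Ker L] and [Im L] meet trivially, [F x = F y] splits into
    [L.[x - y] = 0] and the vanishing of the [gamma]-combination of the traces;
    as the traces lie in [K] and [gamma] is free over [K], the latter means that
    every trace of [h_i(x) - h_i(y)] is zero. On the finite field [E], being a
    permutation is the same as being injective. *)

(** [finvect_type E] equips [E] with the finite type structure needed for counting. *)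
Lemma inj_bij_fieldExt (K : finFieldType) (E : fieldExtType K) (f : E -> E) :
  injective f -> bijective f.
Proof. exact: (@injF_bij (finvect_type E)). Qed.

Lemma TrB (K : finFieldType) (E : fieldExtType K) m (x y : E) :
  Tr #|K| m (x - y) = Tr #|K| m x - Tr #|K| m y.
Proof.
rewrite /Tr -sumrB; apply: eq_bigr => i _.
by rewrite -[in RHS](subrK y x) [in RHS]exprD_cardX addrK.
Qed.

(** The line [1] is the fixed field of the [#|K|]-th power map, which permutes the terms of the
    trace cyclically. *)
Lemma Tr_mem1 (K : finFieldType) (E : fieldExtType K) (x : E) :
  Tr #|K| (\dim {:E}) x \in 1%VS.
Proof.
have xq : x ^+ (#|K| ^ \dim {:E}) = x.
  by apply/eqP; rewrite -(Fermat's_little_theorem {:E}%AS) memvf.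
have TrX m : Tr #|K| m x ^+ #|K| = \sum_(i < m) x ^+ (#|K| ^ i.+1).
  elim: m => [|m IHm]; rewrite /Tr ?big_ord0.
    by rewrite expr0n eqn0Ngt (ltnW (finNzRing_gt1 K)).
  by rewrite !big_ord_recr /= -IHm -[in LHS](expn1 #|K|) exprD_cardX expn1
    -exprM -expnSr.
rewrite (Fermat's_little_theorem 1%AS) dimv1 expn1 TrX /Tr.
(* As the dimension is positive, the last term of the shifted sum can be split off; by [xq] it is
   [x], the first term of the trace. *)
apply/eqP; move: xq (adim_gt0 {:E}%AS); case: (\dim _) => // m xq _.
by rewrite big_ord_recr /= xq big_ord_recl expn0 expr1 addrC.
Qed.

Lemma free_sum_mul_eq0 (K : fieldType) (E : fieldExtType K) l
    (gamma : l.-tuple E) (t : 'I_l -> E) :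
  free gamma -> (forall i, t i \in 1%VS) ->
  \sum_(i < l) tnth gamma i * t i = 0 -> forall i, t i = 0.
Proof.
move=> /freeP gamma_free t1.
have /fin_all_exists[c tE] i : exists c, t i = c%:A.
  by have /vlineP[c ->] := t1 i; exists c.
move=> sum0 i; rewrite tE (gamma_free c) ?scale0r // -[RHS]sum0.
by apply: eq_bigr => j _; rewrite tE -tnth_nth mulr_algr.
Qed.

Lemma horner_Tr (R : comNzRingType) q m (f : {poly R}) x :
  (Tr q m f).[x] = Tr q m f.[x].
Proof. by rewrite horner_sum; apply: eq_bigr => i _; rewrite horner_exp. Qed.

Theorem theorem3p1
  (p n q m l k : nat) (p_prime : prime p) (n_ge1 : (1 <= n)%N)
  (q_def : q = (p ^ n)%N) (m_gt1 : (1 < m)%N)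
  (l_gt0 : (0 < l)%N) (k_gt0 : (0 < k)%N) (le_lk : (l <= k)%N)
  (K : finFieldType) (E : fieldExtType K)
  (cardK : #|K| = q) (dimE : \dim {:E} = m)
  (L : {poly E}) (L_lin : linearized q m L)
  (dim_Ker : \dim (Ker L) = k) (Ker_Im : (Ker L :&: Im L)%VS = 0%VS)
  (gamma : l.-tuple E) (gamma_Ker : forall i : 'I_l, tnth gamma i \in Ker L)
  (gamma_free : free gamma)
  (h : 'I_l -> {poly E}) :
  permutation_poly (L + \sum_(i < l) tnth gamma i *: Tr q m (h i))
  <->
  (forall x eps : E, eps \in Ker L -> eps != 0 ->
    exists i : 'I_l, Tr q m ((h i).[x + eps] - (h i).[x]) != 0).
Proof.
rewrite -cardK in L_lin *.
set F := L + _; pose d x y i := Tr #|K| m ((h i).[x] - (h i).[y]).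
have FB x y : F.[x] - F.[y] = L.[x - y] + \sum_(i < l) tnth gamma i * d x y i.
  have -> : L.[x - y] = L.[x] - L.[y] by rewrite -!(poly_linE L_lin) linearB.
  rewrite !hornerD opprD addrACA.
  rewrite !horner_sum -sumrB; congr (_ + _); apply: eq_bigr => i _.
  by rewrite !hornerZ !horner_Tr -mulrBr -TrB.
split=> [/bij_inj F_inj x eps epsK eps0 | Hh].
  (* Contrapositive: if all traces vanish, then [x + eps] and [x] have the same image under [F], so
     [eps] is zero. *)
  apply/existsP; apply: contraR eps0 => /existsPn d0.
  rewrite -(inj_eq (addrI x)) addr0; apply/eqP/F_inj/eqP; rewrite -subr_eq0 FB.
  rewrite [x + eps - x]addrAC subrr add0r -(poly_linE L_lin).
  have/eqP-> : poly_lin L eps == 0 by rewrite -memv_ker.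
  rewrite add0r big1 // => i _.
  by have := d0 i; rewrite negbK /d => /eqP->; rewrite mulr0.
apply: inj_bij_fieldExt => x y /eqP; rewrite -subr_eq0 FB => /eqP sum0.
have d1 i : d x y i \in 1%VS by rewrite /d -dimE Tr_mem1.
have sumK : \sum_(i < l) tnth gamma i * d x y i \in Ker L.
  apply: memv_suml => i _; have /vlineP[c ->] := d1 i.
  by rewrite mulr_algr memvZ.
(* By [sum0] this value is the opposite of a sum in [Ker L]; it is also in [Im L]. *)
have Lxy0 : L.[x - y] = 0.
  apply/eqP; rewrite -memv0 -Ker_Im memv_cap; apply/andP; split.
    by rewrite (canRL (addrK _) sum0) sub0r memvN.
  by apply/(mem_Im L_lin); exists (x - y).
rewrite Lxy0 add0r in sum0.
have d0 := free_sum_mul_eq0 _ _ _ _ _ gamma_free d1 sum0.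
apply/eqP; rewrite -subr_eq0; apply/negP => /negP xy0.
(* The index [i] may depend on both [y] and the shift [x - y]; any one nonzero trace contradicts
   [d0]. *)
have [|i] := Hh y (x - y) _ xy0; first by rewrite (mem_Ker L_lin) /root Lxy0.
by rewrite (addrC y) subrK -/(d x y i) d0 eqxx.
Qed.
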